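(* Let $\mathcal{A}$ be a finite alphabet and $k\ge 2$. Any strongly $k$-product-free subset $S$ of the free semigroup over $\mathcal{A}$ has upper asymptotic density at most $1/k$.
   Context: A subset $S$ of a semigroup is $\ell$-product-free ($\ell\ge2$) if there are no $x_1,\dots,x_\ell,y\in S$ (not necessarily distinct) with $x_1\cdots x_\ell=y$; it is strongly $k$-product-free if it is $\ell$-product-free for every $2\le\ell\le k$. The free semigroup over $\mathcal{A}$ consists of nonempty finite words over $\mathcal{A}$ with concatenation. It carries the measure $\mu$ assigning weight $|\mathcal{A}|^{-n}$ to every word of length $n$ (so each length layer has total weight one), and the upper asymptotic density of a set $A$ is $\limsup_{n\to\infty}\mu(A_{\le n})/\mu(\text{all words of length}\le n)$, where $A_{\le n}$ is the set of words of $A$ of length at most $n$. *)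

(* Defs.v *)
From mathcomp Require Import all_boot all_order all_algebra.
From mathcomp Require Import all_classical all_reals all_analysis.
Set Implicit Arguments. Unset Strict Implicit. Unset Printing Implicit Defensive.
Import Order.TTheory GRing.Theory Num.Theory.
Local Open Scope ring_scope.

(* The free semigroup over alphabet A: nonempty words (seq A), product = concatenation.
   A subset of it is a predicate S on seq A containing only nonempty words. *)
Definition subset_free_semigroup (A : finType) (S : pred (seq A)) : Prop :=
  forall w, S w -> w != [::].

Definition l_product_free (A : finType) (l : nat) (S : pred (seq A)) : Prop :=
  ~ exists (xs : seq (seq A)) (y : seq A),
      [/\ size xs = l, all S xs, S y & flatten xs = y].

Definition strongly_product_free (A : finType) (k : nat) (S : pred (seq A)) : Prop :=
  forall l, (2 <= l <= k)%N -> l_product_free l S.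

Definition layer_measure (R : realType) (A : finType) (S : pred (seq A)) (m : nat) : R :=
  #|[set t : m.-tuple A | S (tval t)]|%:R / (#|A|%:R ^+ m).

(* mu(S_{<= n}) / mu(all words of length <= n); the latter equals n
   (words have length >= 1, each layer has total weight 1). *)
Definition density_ratio (R : realType) (A : finType) (S : pred (seq A)) (n : nat) : R :=
  (\sum_(1 <= m < n.+1) layer_measure R S m) / (\sum_(1 <= m < n.+1) (1 : R)).

Definition upper_density (R : realType) (A : finType) (S : pred (seq A)) : \bar R :=
  limn_esup (fun n => (density_ratio R S n)%:E).

(* Main.v *)
(** Write [h L M] for the probability that a uniformly random long word has a
    prefix in [S] of length in [[L, M]].  If [inf_L sup_M h L M = 0] then [S] has
    density 0.  Otherwise pick [L], [M] where the inf-sup is nearly attained, and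
    let [K] be the set of words having such a prefix: membership in [K] depends
    only on the first [M] letters, and almost all of [S] lies in [K].

    Consider finite [V] contained in both [S] and [K] such that words of [V K]
    factor uniquely.  Since [V K] lies in [K], the weight [mu V] is at most 1.
    If [V] has nearly maximal weight, then [mu V] is nearly 1: a random word of
    [K] almost surely has further, arbitrarily long prefixes in [S], so those in
    [K] but outside [V K] could otherwise be added to [V].

    For [X] the intersection of [S] and [K], the sets [X, V X, ..., V^(k-1) X]
    are pairwise disjoint, by unique factorization and product-freeness, and they
    all have asymptotically almost the same density, whence the bound [1/k]. *)

Require Import Defs.
From mathcomp Require Import all_boot all_order all_algebra.
From mathcomp Require Import all_classical all_reals all_analysis.
From mathcomp Require Import lra zify.
Set Implicit Arguments. Unset Strict Implicit. Unset Printing Implicit Defensive.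
Import Order.TTheory GRing.Theory Num.Theory.
Local Open Scope ring_scope.

(** * Prefixes, products of sets of words, and unique parsing *)

Section Words.
Context {A : finType}.
Implicit Types (S V X Y K G : pred (seq A)) (u v w x : seq A) (L M D m n : nat).

Lemma cat_eq_prefix u x u' x' : u ++ x = u' ++ x' -> (size u <= size u')%N ->
  exists v, u' = u ++ v /\ x = v ++ x'.
Proof.
move=> e le; exists (drop (size u) u').
have eu : take (size u) u' = u.
  by rewrite -(takel_cat x' le) -e take_size_cat.
have eu' : u' = u ++ drop (size u) u' by rewrite -{1}eu cat_take_drop.
split=> //; apply/eqP; move/eqP: e; rewrite {1}eu' -catA eqseq_cat //.
by case/andP.
Qed.

(** The slice of [concat V X] cut at length [m]. The two factors of a slice are independent, so its
    layer weight is a product; under unique parsing the slices are disjoint. *)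
Definition split_at m V X : pred (seq A) :=
  fun w => [&& (m <= size w)%N, V (take m w) & X (drop m w)].

Definition concat V X : pred (seq A) :=
  fun w => [exists j : 'I_(size w).+1, V (take j w) && X (drop j w)].

Definition hits S L M : pred (seq A) :=
  fun w => [exists j : 'I_(size w).+1, [&& (L <= j)%N, (j <= M)%N & S (take j w)]].

Definition minimal G : pred (seq A) :=
  fun u => G u && ~~ [exists j : 'I_(size u), G (take j u)].

Lemma split_atP m V X w :
  reflect (exists u x, [/\ w = u ++ x, size u = m, V u & X x]) (split_at m V X w).
Proof.
apply: (iffP and3P) => [[le Vw Xw]|[u [x [-> <- Vu Xx]]]].
  by exists (take m w), (drop m w); rewrite cat_take_drop size_takel.
by rewrite size_cat leq_addr take_size_cat // drop_size_cat.
Qed.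

Lemma concatP V X w :
  reflect (exists u x, [/\ w = u ++ x, V u & X x]) (concat V X w).
Proof.
apply: (iffP existsP) => [[j /andP[Vj Xj]]|[u [x [-> Vu Xx]]]].
  by exists (take j w), (drop j w); rewrite cat_take_drop.
have lu : (size u < (size (u ++ x)).+1)%N by rewrite size_cat ltnS leq_addr.
by exists (Ordinal lu); rewrite /= take_size_cat // drop_size_cat // Vu.
Qed.

Lemma hitsP S L M w :
  reflect (exists u x, [/\ w = u ++ x, (L <= size u <= M)%N & S u]) (hits S L M w).
Proof.
apply: (iffP existsP) => [[j /and3P[Lj jM Sj]]|[u [x [-> /andP[Lu uM] Su]]]].
  exists (take j w), (drop j w); rewrite cat_take_drop size_takel ?Lj ?jM //.
  by rewrite -ltnS.
have lu : (size u < (size (u ++ x)).+1)%N by rewrite size_cat ltnS leq_addr.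
by exists (Ordinal lu); rewrite /= take_size_cat // Lu uM.
Qed.

Lemma hits_cat S L M w x : hits S L M w -> hits S L M (w ++ x).
Proof.
by move=> /hitsP[u [y [-> uLM Su]]]; apply/hitsP; exists u, (y ++ x); rewrite -catA.
Qed.

(** Only the first [M] letters are inspected. This makes the layer weight constant from [M] on, and
    lets membership pass from a word to any prefix of length at least [M]. *)
Lemma hits_take S L M w : (M <= size w)%N -> hits S L M w = hits S L M (take M w).
Proof.
move=> Mw; apply/idP/idP => [/hitsP[u [x [e uLM Su]]]|H]; last first.
  by rewrite -(cat_take_drop M w); apply: hits_cat.
have /andP[_ uM] := uLM.
have e' : u ++ x = take M w ++ drop M w by rewrite cat_take_drop.
have [|v [ev _]] := cat_eq_prefix e'; first by rewrite size_takel.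
by apply/hitsP; exists u, v.
Qed.

Lemma hits_widen S L M L' M' w : (L' <= L)%N -> (M <= M')%N ->
  hits S L M w -> hits S L' M' w.
Proof.
move=> LL MM /hitsP[u [x [-> /andP[Lu uM] Su]]]; apply/hitsP; exists u, x.
by rewrite (leq_trans LL Lu) (leq_trans uM MM).
Qed.

Lemma minimalW G u : minimal G u -> G u.
Proof. by case/andP. Qed.

Lemma minimal_prefix_free G u v : minimal G u -> minimal G (u ++ v) -> v = [::].
Proof.
case: v => // a v /andP[Gu _] /andP[_ /negP[]]; apply/existsP.
have lu : (size u < size (u ++ a :: v))%N by rewrite size_cat /= addnS ltnS leq_addr.
by exists (Ordinal lu); rewrite /= take_size_cat.
Qed.

Lemma exists_minimal_prefix G u : G u -> exists b v, u = b ++ v /\ minimal G b.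
Proof.
move=> Gu; have exG : exists j, (j <= size u)%N && G (take j u).
  by exists (size u); rewrite leqnn take_size.
case: (ex_minnP exG) => j /andP[ju Gj] jmin.
exists (take j u), (drop j u); rewrite cat_take_drop; split=> //.
rewrite /minimal Gj; apply/negP => /existsP[[i /=]]; rewrite size_takel // => ij.
rewrite take_takel ?(ltnW ij) // => Gi.
by have := jmin i; rewrite Gi (leq_trans (ltnW ij) ju) => /(_ isT); rewrite leqNgt ij.
Qed.

(** Weaker than [V] being prefix-free: one word of [V] may extend another as long as the two never
    give the same word with remainders in [X]. *)
Definition uniquely_parsed V X := forall u u' x x',
  V u -> V u' -> X x -> X x' -> u ++ x = u' ++ x' -> u = u' /\ x = x'.

(** By symmetry the first factor [u] may be taken to be the shorter one, hence a prefix of the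
    other; it remains to show that the overhang [v] is empty. *)
Lemma uniquely_parsed_le V X :
  (forall u v x x', V u -> V (u ++ v) -> X x -> X x' -> x = v ++ x' -> v = [::]) ->
  uniquely_parsed V X.
Proof.
move=> H u u' x x'.
wlog le : u u' x x' / (size u <= size u')%N => [Hw Vu Vu' Xx Xx' e|Vu Vu' Xx Xx' e].
  have [le|lt] := leqP (size u) (size u'); first exact: Hw.
  by have [] := Hw _ _ _ _ (ltnW lt) Vu' Vu Xx' Xx (esym e).
have [v [eu' ex]] := cat_eq_prefix e le; subst u'.
have v0 := H _ _ _ _ Vu Vu' Xx Xx' ex.
by rewrite ex v0 cats0.
Qed.

Lemma uniquely_parsedS V X Y : (forall w, Y w -> X w) ->
  uniquely_parsed V X -> uniquely_parsed V Y.
Proof. by move=> YX H u u' x x' Vu Vu' /YX Xx /YX Xx'; apply: H. Qed.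

Lemma sum_at_most_one (I : finType) (p : pred I) :
  (forall i j, p i -> p j -> i = j) -> (\sum_i p i = [exists i, p i])%N.
Proof.
move=> H; case: existsP => [[i pi]|nex].
  rewrite (bigD1 i) //= pi big1 // => j /eqP ji.
  by case pj: (p j) => //; case: ji; apply: H.
by rewrite big1 // => i _; case pi: (p i) => //; case: nex; exists i.
Qed.

Lemma concat_sum V X D w : uniquely_parsed V X ->
  (forall u, V u -> size u < D)%N ->
  (concat V X w = \sum_(m < D) split_at m V X w :> nat)%N.
Proof.
move=> uV VD; rewrite sum_at_most_one => [|i j]; last first.
  move=> /split_atP[u [x [ew su Vu Xx]]] /split_atP[u' [x' [ew' su' Vu' Xx']]].
  apply: val_inj; rewrite /= -su -su'; congr size.
  by have [] := uV u u' x x' Vu Vu' Xx Xx' (etrans (esym ew) ew').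
congr nat_of_bool; apply/concatP/existsP => [[u [x [ew Vu Xx]]]|[m]].
  by exists (Ordinal (VD _ Vu)); apply/split_atP; exists u, x.
by move=> /split_atP[u [x [ew _ Vu Xx]]]; exists u, x.
Qed.

End Words.

(** * Layer weights as probabilities for a uniformly random word *)

Section Layers.
Context {R : realType} {A : finType}.
Context (A0 : (0 < #|A|)%N).
Implicit Types (S V X Y K G : pred (seq A)) (u v w x : seq A) (L M D m n : nat).
Local Notation P := (@layer_measure R A).

Lemma layer_measureE X n : P X n = (\sum_(t : n.-tuple A) (X t)%:R) / #|A|%:R ^+ n.
Proof.
rewrite /layer_measure -sum1_card natr_sum; congr (_ / _).
rewrite big_mkcond; apply: eq_bigr => t _; rewrite inE.
by case: (X t).
Qed.

Lemma layer_measure_ge0 X n : 0 <= P X n.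
Proof. by rewrite /layer_measure divr_ge0 ?exprn_ge0 ?ler0n. Qed.

(** Double counting: every comparison of weights below (inclusion, disjoint union, covering) is
    reduced to an inequality of indicator sums at a single word. *)
Lemma sum_layer_measure I J (r : seq I) (s : seq J)
    (X : I -> pred (seq A)) (Y : J -> pred (seq A)) n :
  (forall w, size w = n -> \sum_(i <- r) X i w <= \sum_(j <- s) Y j w)%N ->
  \sum_(i <- r) P (X i) n <= \sum_(j <- s) P (Y j) n.
Proof.
move=> H.
have E T (q : seq T) (Z : T -> pred (seq A)) : \sum_(i <- q) P (Z i) n =
    (\sum_(t : n.-tuple A) (\sum_(i <- q) Z i t)%:R) / #|A|%:R ^+ n.
  under eq_bigr do rewrite layer_measureE.
  rewrite -mulr_suml exchange_big /=; congr (_ / _).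
  by apply: eq_bigr => t _; rewrite natr_sum.
rewrite !E ler_wpM2r ?invr_ge0 ?exprn_ge0 ?ler0n //.
by apply: ler_sum => t _; rewrite ler_nat H ?size_tuple.
Qed.

Lemma layer_measureS X Y n : (forall w, size w = n -> X w -> Y w) -> P X n <= P Y n.
Proof.
move=> XY; have := @sum_layer_measure _ _ [:: X] [:: Y] id id n.
rewrite !big_seq1; apply=> w sw; rewrite !big_seq1.
by case Xw: (X w) => //; rewrite XY.
Qed.

Lemma eq_layer_measure X Y n : (forall w, size w = n -> X w = Y w) -> P X n = P Y n.
Proof. by move=> XY; apply/le_anti/andP; split; apply: layer_measureS => w /XY->. Qed.

Lemma layer_measureT n : P predT n = 1.
Proof.
rewrite layer_measureE sumr_const card_tuple natrX divff //.
by rewrite expf_neq0 // pnatr_eq0 -lt0n.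
Qed.

Lemma layer_measure_le1 X n : P X n <= 1.
Proof. by rewrite -(layer_measureT n); apply: layer_measureS. Qed.

(** The first [m] letters and the remaining ones are independent: concatenation is a bijection from
    pairs of tuples to tuples of length [n]. *)
Lemma layer_measure_split V X m n :
  P (split_at m V X) n = if (m <= n)%N then P V m * P X (n - m) else 0.
Proof.
case: leqP => [mn|nm]; last first.
  by apply/eqP; rewrite layer_measureE big1 ?mul0r // => t _; rewrite /split_at size_tuple leqNgt nm.
rewrite -{1}(subnKC mn); move: (n - m)%N => p {n mn}.
rewrite !layer_measureE mulrACA -invfM -exprD; congr (_ / _).
rewrite big_distrl /=; under [RHS]eq_bigr do rewrite big_distrr /=.
rewrite pair_bigA /=.
rewrite (reindex (fun q : m.-tuple A * p.-tuple A => [tuple of q.1 ++ q.2])) /=.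
  apply: eq_bigr => -[t s] _ /=.
  rewrite /split_at size_cat size_tuple leq_addr take_size_cat ?size_tuple //.
  by rewrite drop_size_cat ?size_tuple //= -natrM mulnb.
have inj : injective (fun q : m.-tuple A * p.-tuple A => [tuple of q.1 ++ q.2]).
  move=> [t s] [t' s'] /= /(congr1 val) /= /eqP.
  rewrite eqseq_cat ?size_tuple // => /andP[/eqP/val_inj-> /eqP/val_inj->//].
apply: onW_bij; apply: (inj_card_bij inj).
by rewrite card_prod !card_tuple expnD.
Qed.

Lemma layer_measure_take V m n : (m <= n)%N -> P (fun w => V (take m w)) n = P V m.
Proof.
move=> mn; rewrite -[RHS]mulr1 -(layer_measureT (n - m)).
have := layer_measure_split V predT m n; rewrite mn => <-.
by apply: eq_layer_measure => w sw; rewrite /split_at sw mn andbT.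
Qed.

Lemma layer_measure_hits S L M n : (M <= n)%N -> P (hits S L M) n = P (hits S L M) M.
Proof.
move=> Mn; rewrite -(layer_measure_take _ Mn).
by apply: eq_layer_measure => w sw; rewrite -hits_take ?sw.
Qed.

(** The weights of a uniquely parsed product are the convolution of the weights of its factors. *)
Lemma layer_measure_concat V X D n : uniquely_parsed V X ->
  (forall u, V u -> size u < D)%N ->
  P (concat V X) n = \sum_(m < D) if (m <= n)%N then P V m * P X (n - m) else 0.
Proof.
move=> uV VD; under eq_bigr do rewrite -layer_measure_split.
apply/le_anti/andP; split.
  have := @sum_layer_measure _ _ [:: concat V X] (index_enum 'I_D) id
    (fun m : 'I_D => split_at m V X) n.
  by rewrite big_seq1; apply=> w _; rewrite big_seq1 (concat_sum w uV VD).
have := @sum_layer_measure _ _ (index_enum 'I_D) [:: concat V X]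
  (fun m : 'I_D => split_at m V X) id n.
by rewrite big_seq1; apply=> w _; rewrite big_seq1 (concat_sum w uV VD).
Qed.

End Layers.

(** * Disjointness of the sets [X], [V X], ..., [V^(k-1) X] *)

Section Iteration.
Context {A : finType} (k : nat) (S V X K : pred (seq A)).
Context (Sfree : strongly_product_free k S).
Context (VS : forall u, V u -> S u) (XS : forall w, X w -> S w).
Context (XK : forall w, X w -> K w) (VK : forall w, concat V K w -> K w).
Context (parse : uniquely_parsed V K).

Lemma iter_concat_flatten i w : iter i (concat V) X w ->
  exists us x, [/\ size us = i, all V us, X x & w = flatten us ++ x].
Proof.
elim: i w => [|i IH] w /=; first by exists [::], w.
move=> /concatP[u [y [-> Vu /IH[us [x [<- Vus Xx ->]]]]]].
by exists (u :: us), x; rewrite /= Vu catA.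
Qed.

Lemma iter_concat_sub i w : iter i (concat V) X w -> K w.
Proof.
elim: i w => [|i IH] w /=; first exact: XK.
by move=> /concatP[u [y [-> Vu /IH Ky]]]; apply: VK; apply/concatP; exists u, y.
Qed.

(** Unique parsing strips the [i] common factors from [V]. What remains is a word of [X], hence of
    [S], that is also a product of [d.+1] words of [V] and one of [X]: a forbidden product of
    [d.+2 <= k] elements of [S]. *)
Lemma iter_concat_disjoint i d w : (d.+1 < k)%N ->
  iter i (concat V) X w -> iter (i + d.+1) (concat V) X w -> False.
Proof.
move=> dk; elim: i w => [|i IH] w.
  move=> /= Xw /(@iter_concat_flatten d.+1)[us [x [su Vus Xx ew]]].
  apply: (Sfree (l := d.+2)); first by rewrite dk.
  exists (rcons us x), w; split; rewrite ?size_rcons ?su ?flatten_rcons ?XS //.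
  by rewrite all_rcons XS //; apply: sub_all Vus.
rewrite addSn => /concatP[u [y [-> Vu Xy]]] /concatP[u' [y' [e Vu' Xy']]].
have [_ ey] := parse Vu Vu' (iter_concat_sub Xy) (iter_concat_sub Xy') e.
by apply: (IH y) => //; rewrite ey.
Qed.

Lemma iter_concat_inj (i j : 'I_k) w :
  iter i (concat V) X w -> iter j (concat V) X w -> i = j.
Proof.
wlog le : i j / (i <= j)%N => [H Xi Xj|Xi Xj].
  by have [le|/ltnW le] := leqP i j; [exact: H|exact/esym/H].
apply: val_inj => /=; apply/eqP; rewrite eqn_leq le /= leqNgt; apply/negP => lt.
apply: (@iter_concat_disjoint i (j - i).-1 w) => //.
  by have := ltn_ord j; lia.
by have -> : (i + (j - i).-1.+1 = j)%N by lia.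
Qed.

End Iteration.

(** * Cumulative weights of products *)

Section Counting.
Context {R : realType} {A : finType}.
Context (A0 : (0 < #|A|)%N).
Implicit Types (S V X Y K G : pred (seq A)) (u v w x : seq A) (L M D m n N : nat).
Local Notation P := (@layer_measure R A).

(** A shift by [m] pushes at most [m] terms past the end, each at most 1. *)
Lemma sum_shift_ge (f : nat -> R) m N : (forall n, 0 <= f n <= 1) ->
  \sum_(n < N) f n - m%:R <= \sum_(n < N) if (m <= n)%N then f (n - m)%N else 0.
Proof.
move=> f01.
have fle q (g : 'I_q -> nat) : \sum_(n < q) f (g n) <= q%:R.
  rewrite -[in leRHS](card_ord q) -sum1_card natr_sum; apply: ler_sum => i _.
  by case/andP: (f01 (g i)).
have [mN|Nm] := leqP m N; last first.
  apply: (@le_trans _ _ 0); last first.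
    by apply: sumr_ge0 => i _; case: ifP => // _; case/andP: (f01 (i - m)%N).
  rewrite subr_le0; apply: (le_trans (fle N (@nat_of_ord N))).
  by rewrite ler_nat ltnW.
rewrite -(subnKC mN); move: (N - m)%N => p {N mN}.
rewrite [leRHS]big_split_ord /= [X in _ <= X + _]big1 => [|i _]; last first.
  by rewrite leqNgt ltn_ord.
rewrite add0r addnC big_split_ord /= lerBlDr lerD //.
  by apply: ler_sum => i _; rewrite leq_addr addKn.
exact: (fle m (fun i : 'I_m => p + i)%N).
Qed.

Lemma cumulative_le X N : \sum_(n < N) P X n <= N%:R.
Proof.
rewrite -[in leRHS](card_ord N) -sum1_card natr_sum; apply: ler_sum => i _.
exact: layer_measure_le1.
Qed.

(** Multiplying by [V] averages shifts of [X] with total mass [mu]: the shifts cost at most [D], the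
    missing mass at most [(1 - mu) * N]. *)
Lemma cumulative_concat V X D N : uniquely_parsed V X ->
  (forall u, V u -> size u < D)%N -> \sum_(m < D) P V m <= 1 ->
  \sum_(n < N) P X n - (D%:R + (1 - \sum_(m < D) P V m) * N%:R)
    <= \sum_(n < N) P (concat V X) n.
Proof.
move=> uV VD mu1; set mu := \sum_(m < D) _ in mu1 *.
under [leRHS]eq_bigr do rewrite (layer_measure_concat _ uV VD).
set F := \sum_(n < N) P X n.
have FN : F <= N%:R by exact: cumulative_le.
(* The two sides differ by [(1 - mu) * (N - F + D)], which is nonnegative. *)
apply: (@le_trans _ _ (mu * (F - D%:R))).
  have := ler0n R D; nra.
rewrite exchange_big /= mulr_suml; apply: ler_sum => m _.
apply: (@le_trans _ _ (P V m * (F - m%:R))).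
  by rewrite ler_wpM2l ?layer_measure_ge0 // lerB // ler_nat ltnW.
have -> : \sum_(n < N) (if (m <= n)%N then P V m * P X (n - m) else 0) =
    P V m * \sum_(n < N) (if (m <= n)%N then P X (n - m) else 0).
  by rewrite mulr_sumr; apply: eq_bigr => n _; case: ifP => //; rewrite mulr0.
rewrite ler_wpM2l ?layer_measure_ge0 // sum_shift_ge // => n.
by rewrite layer_measure_ge0 layer_measure_le1.
Qed.

(** The [k] disjoint sets [V^i X] share a total of at most [N], and the [i]-th has lost at most
    [i * loss] against [X]; bounding each [i] by [k] gives the factor [k ^ 2]. *)
Lemma cumulative_product_free k S V X K D N :
  strongly_product_free k S ->
  (forall u, V u -> S u) -> (forall w, X w -> S w) ->
  (forall w, X w -> K w) -> (forall w, concat V K w -> K w) ->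
  uniquely_parsed V K ->
  (forall u, V u -> size u < D)%N -> \sum_(m < D) P V m <= 1 ->
  k%:R * \sum_(n < N) P X n
    <= N%:R + k%:R ^+ 2 * (D%:R + (1 - \sum_(m < D) P V m) * N%:R).
Proof.
move=> Sfree VS XS XK VK uV VD mu1.
set loss := (D%:R + _).
have loss0 : 0 <= loss.
  by rewrite addr_ge0 ?ler0n // mulr_ge0 ?ler0n // subr_ge0.
pose Xi i := iter i (concat V) X.
have step i : \sum_(n < N) P X n - i%:R * loss <= \sum_(n < N) P (Xi i) n.
  elim: i => [|i IH]; first by rewrite mul0r subr0.
  have uVi : uniquely_parsed V (Xi i).
    by apply: uniquely_parsedS uV => w; apply: iter_concat_sub.
  have := cumulative_concat N uVi VD mu1; rewrite -/loss => H.
  apply: le_trans H; rewrite -natr1; move: IH; lra.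
have tot : \sum_(i < k) \sum_(n < N) P (Xi i) n <= N%:R.
  rewrite exchange_big /= -[in leRHS](card_ord N) -sum1_card natr_sum.
  apply: ler_sum => n _; rewrite -(layer_measureT (R := R) A0 n).
  have := @sum_layer_measure R A _ _ (index_enum 'I_k) [:: predT] (fun i : 'I_k => Xi i) id n.
  rewrite big_seq1; apply=> w _; rewrite big_seq1 sum_at_most_one ?leq_b1 // => i j.
  exact: (iter_concat_inj Sfree VS XS XK VK uV).
suff : k%:R * (\sum_(n < N) P X n - k%:R * loss) <= N%:R.
  rewrite mulrBr mulrA -expr2; lra.
apply: le_trans tot.
have -> (c : R) : k%:R * c = \sum_(i < k) c by rewrite sumr_const card_ord mulr_natl.
apply: ler_sum => i _; apply: le_trans (step i).
by rewrite lerB // ler_wpM2r // ler_nat ltnW.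
Qed.

End Counting.

(** * Codes [V] of nearly full weight *)

Section Code.
Context {R : realType} {A : finType}.
Context (A0 : (0 < #|A|)%N).
Implicit Types (V G : pred (seq A)) (u v w x : seq A) (D m n N : nat).
Context (S : pred (seq A)) (L M : nat).
Local Notation P := (@layer_measure R A).
Local Notation K := (hits S L M).
Local Notation weight V D := (\sum_(m < D) P V m).

(** The finite sets [V] of the overview. Since [D] exceeds all lengths in [V], [weight V D] is the
    whole weight of [V]. *)
Definition code V D :=
  [/\ forall u, V u -> S u && K u, forall u, V u -> (size u < D)%N
    & uniquely_parsed V K].

Lemma concat_hits V w : (forall u, V u -> S u && K u) -> concat V K w -> K w.
Proof. by move=> VSK /concatP[u [x [-> /VSK/andP[_ Ku] _]]]; apply: hits_cat. Qed.

(** For such [n] every remainder has length at least [M], where the weight of [K] is constant, so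
    the convolution collapses to a product. *)
Lemma layer_measure_code V D n : code V D -> (D + M <= n)%N ->
  P (concat V K) n = weight V D * P K M.
Proof.
move=> [_ VD uV] DMn; rewrite (layer_measure_concat _ uV VD) mulr_suml.
apply: eq_bigr => m _; have mD := ltn_ord m.
by rewrite ifT ?(layer_measure_hits A0) //; lia.
Qed.

Context (K0 : 0 < P K M).

Lemma code_weight_le1 V D : code V D -> weight V D <= 1.
Proof.
move=> cV; rewrite -(ler_pM2r K0) mul1r -(layer_measure_code cV (leqnn _)).
rewrite -(layer_measure_hits A0 S L (leq_addl D M)).
by apply: layer_measureS => w _; apply: concat_hits; case: cV.
Qed.

(** Candidates for enlarging [V]. Only the prefix-minimal ones are added, so that the new words
    cannot conflict with each other. *)
Definition fresh V L' M' : pred (seq A) := fun u =>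
  [&& S u, K u, (L' <= size u <= M')%N & ~~ concat V K u].

(** New words are longer than old ones, so the only delicate case is a new word [u ++ v] extending
    an old [u]. Then [v] has at least [M] letters and is a prefix of [x], so [v] is in [K] along
    with [x], and [u ++ v] in [V K] is not fresh. *)
Lemma code_extend V D L' M' : code V D -> (D + M <= L')%N ->
  code (predU V (minimal (fresh V L' M'))) (maxn D M'.+1).
Proof.
move=> [VSK VD uV] DML.
have BF u : minimal (fresh V L' M') u -> fresh V L' M' u by exact: minimalW.
split=> [u|u|].
- by case/orP => [/VSK//|/BF/and4P[-> ->]].
- case/orP => [/VD|/BF/and4P[_ _ /andP[_ uM] _]]; rewrite leq_max ltnS ?uM ?orbT //.
  by move=> ->.
apply: uniquely_parsed_le => u v x x' Vu Vuv Kx Kx' ex.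
case/orP: Vu => Vu; case/orP: Vuv => Vuv.
- have exv : u ++ x = (u ++ v) ++ x' by rewrite ex catA.
  have [/(congr1 size) sv _] := uV _ _ _ _ Vu Vuv Kx Kx' exv.
  by apply: size0nil; move: sv; rewrite size_cat; lia.
- have /and4P[_ _ /andP[Luv _] /negP[]] := BF _ Vuv.
  apply/concatP; exists u, v; split=> //.
  have uD := VD _ Vu; rewrite size_cat in Luv.
  have Mv : (M <= size v)%N by lia.
  by rewrite hits_take // -(takel_cat x' Mv) -ex -hits_take // ex size_cat; lia.
- have uvD := VD _ Vuv; rewrite size_cat in uvD.
  by have /and4P[_ _ /andP[Lu _] _] := BF _ Vu; lia.
- exact: minimal_prefix_free Vu Vuv.
Qed.

(** Old and new words are disjoint, because their lengths lie on either side of [D]. *)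
Lemma weight_extend V D L' M' : code V D -> (D + M <= L')%N ->
  weight V D + weight (minimal (fresh V L' M')) M'.+1
   <= weight (predU V (minimal (fresh V L' M'))) (maxn D M'.+1).
Proof.
move=> [_ VD _] DML; set B := minimal _.
have widen (f : nat -> R) a b : (forall i, 0 <= f i) -> (a <= b)%N ->
    \sum_(i < a) f i <= \sum_(i < b) f i.
  move=> f0 /subnKC <-; rewrite big_split_ord /= lerDl.
  by apply: sumr_ge0 => i _.
apply: (@le_trans _ _ (weight V (maxn D M'.+1) + weight B (maxn D M'.+1))).
  by rewrite lerD // widen ?leq_maxl ?leq_maxr // => i; apply: layer_measure_ge0.
rewrite -big_split; apply: ler_sum => m _ /=.
have := @sum_layer_measure R A _ _ [:: V; B] [:: predU V B] id id m.
rewrite !big_cons !big_nil !addr0; apply=> w _.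
rewrite !big_cons !big_nil !addn0 /=.
case Vw: (V w) => /=; last by [].
case Bw: (B w) => //=; have := VD _ Vw.
by have /and4P[_ _ /andP[Lw _] _] := minimalW Bw; lia.
Qed.

(* Each word of [K] with a prefix in [S] of length in [[L', M']] lies in [V K] or
   extends a minimal fresh word; the inequality bounds the exceptional words of [K] by
   [h L M' - h L' M'], with the subtracted terms moved across. *)
Lemma hits_cover V D L' M' : code V D -> (D + M <= L')%N -> (L <= L')%N ->
  (L' <= M')%N ->
  P K M + P (hits S L' M') M' <=
  weight V D * P K M + P (hits S L M') M' + weight (minimal (fresh V L' M')) M'.+1.
Proof.
move=> cV DML LL' LM'; set B := minimal _.
(* A layer late enough for all the weights involved to have stabilised, so that the claim becomes a
   covering of single words of length [n]. *)
pose n := (D + M')%N.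
have [DMn Mn M'n] : [/\ D + M <= n, M <= n & M' <= n]%N by rewrite /n; split; lia.
rewrite -(layer_measure_code cV DMn) -(layer_measure_hits A0 S L Mn).
rewrite -(layer_measure_hits A0 S L M'n) -(layer_measure_hits A0 S L' M'n).
have -> : weight B M'.+1 = \sum_(m < M'.+1) P (split_at m B predT) n.
  apply: eq_bigr => m _; rewrite layer_measure_split (layer_measureT A0) mulr1 ifT //.
  by have := ltn_ord m; lia.
have := @sum_layer_measure R A _ _ [:: K; hits S L' M']
  (concat V K :: hits S L M' :: [seq split_at m B predT | m : 'I_M'.+1]) id id n.
rewrite !big_cons !big_nil !addr0 addrA big_image /=; apply=> w _.
rewrite !big_cons !big_nil !addn0 big_image /=.
have [Kw|_] := boolP (K w); last first.
  case: (boolP (hits S L' M' w)) => // Hw; rewrite (hits_widen LL' (leqnn _) Hw).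
  by rewrite addnCA leq_addr.
have -> : hits S L M' w by apply: hits_widen Kw => //; lia.
have [VKw|nVKw] := boolP (concat V K w); first by case: (hits S L' M' w); lia.
case: (boolP (hits S L' M' w)) => // /hitsP[p [x [ew /andP[Lp pM] Sp]]].
have Mp : (M <= size p)%N by lia.
(* [p] is in [K] since it is a prefix of [w] of length at least [M]; if [p] were in [V K], so would
   be its extension [w]. *)
have Fp : fresh V L' M' p.
  rewrite /fresh Sp Lp pM /= hits_take // -(takel_cat x Mp) -ew -hits_take ?Kw.
    apply: contra nVKw => /concatP[u [y [ep Vu Ky]]].
    by apply/concatP; exists u, (y ++ x); rewrite catA -ep hits_cat.
  by rewrite ew size_cat; lia.
have [b [y [ep Bb]]] := exists_minimal_prefix Fp.
have bM : (size b < M'.+1)%N by move: pM; rewrite ep size_cat; lia.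
rewrite add0n leq_add2l (bigD1 (Ordinal bM)) //=.
suff -> : split_at (size b) B predT w by [].
by apply/split_atP; exists b, (y ++ x); rewrite catA -ep.
Qed.

(** Take [V] within [eps] of the supremal weight. Adding the minimal fresh words gains at most
    [eps], and the tail hypothesis bounds the exceptional words of [K] by another [eps]. *)
Lemma exists_heavy_code (eps : R) : 0 < eps ->
  (forall L', exists2 M', (L' <= M')%N &
     P (hits S L M') M' - P (hits S L' M') M' <= eps) ->
  exists V D, code V D /\ P K M * (1 - weight V D) <= 2 * eps.
Proof.
move=> eps0 tail.
pose E : set R := [set x | exists V D, code V D /\ x = weight V D]%classic.
have E1 : has_ubound E by exists 1 => _ [V [D [cV ->]]]; exact: code_weight_le1 cV.
have hE : has_sup E.
  by split=> //; exists (weight pred0 0), pred0, 0%N; split.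
have [_ [V [D [cV ->]]] supV] := sup_adherent eps0 hE.
exists V, D; split=> //.
have [M' LM' tailM'] := tail (maxn L (D + M)).
have DML := leq_maxr L (D + M); have LL' := leq_maxl L (D + M).
have cov := hits_cover cV DML LL' LM'.
have ext := weight_extend M' cV DML.
have := ub_le_sup E1 (ex_intro _ _ (ex_intro _ _ (conj (code_extend M' cV DML) erefl))).
move: cov ext tailM' supV; set B := minimal _.
set a := P (hits S _ M') M'; set b := P (hits S L M') M'; set c := weight B _.
move=> *; nra.
Qed.

End Code.

(** * Near-optimal scales for the inf-sup of [h] *)

Section Scales.
Context {R : realType} (h : nat -> nat -> R).
Context (h01 : forall L M, 0 <= h L M <= 1).
Context (hmono : forall L M M', (M <= M')%N -> h L M <= h L M').

(** The cases are whether [inf_L sup_M h L M] is zero or positive. In the second, [delta] is half of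
    it and is fixed before [eps], because the later error is of order [eps / delta]. *)
Lemma scale_dichotomy :
  (forall e, 0 < e -> exists L, forall M, h L M <= e) \/
  exists2 delta, 0 < delta & forall eps, 0 < eps -> exists L M,
    [/\ delta <= h L M, forall n, h L n - h L M <= eps
      & forall L', exists2 M', (L' <= M')%N & h L M' - h L' M' <= eps].
Proof.
pose s L := sup (range (h L)).
have ubh L : has_ubound (range (h L)).
  by exists 1 => _ [M _ <-]; case/andP: (h01 L M).
have hs L M : h L M <= s L by apply: ub_le_sup => //; exists M.
have supsh L : has_sup (range (h L)) by split=> //; exists (h L 0), 0%N.
have lbs : has_lbound (range s).
  by exists 0 => _ [L _ <-]; apply: le_trans (hs L 0%N); case/andP: (h01 L 0%N).
have infs : has_inf (range s) by split=> //; exists (s 0%N), 0%N.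
have qs L : inf (range s) <= s L by apply: ge_inf => //; exists L.
have [q0|q0] := leP (inf (range s)) 0.
  left=> e e0; have [_ [L _ <-] sL] := inf_adherent e0 infs.
  by exists L => M; have := hs L M; lra.
right; exists (inf (range s) / 2); first lra.
(* Two errors [eta] must add up to at most [eps], and one must leave [h L M] above half the
   infimum. *)
move=> eps eps0; pose eta := Num.min eps (inf (range s)) / 2.
have [eta0 etaeps etaq] : [/\ 0 < eta, 2 * eta <= eps & 2 * eta <= inf (range s)].
  have [m0 me mq] : [/\ 0 < Num.min eps (inf (range s)),
      Num.min eps (inf (range s)) <= eps
    & Num.min eps (inf (range s)) <= inf (range s)].
    by rewrite lt_min eps0 q0 !ge_min !lexx orbT.
  by rewrite /eta; split; lra.
have [_ [L _ <-] sL] := inf_adherent eta0 infs.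
have [_ [M _ <-] hM] := sup_adherent eta0 (supsh L).
exists L, M; split.
- by have := qs L; move: hM; rewrite -/(s L); lra.
- by move=> n; have := hs L n; move: hM; rewrite -/(s L); lra.
move=> L'; have [_ [M' _ <-] hM'] := sup_adherent eta0 (supsh L').
exists (maxn L' M'); first exact: leq_maxl.
have := hmono L' (leq_maxr L' M'); have := hs L (maxn L' M'); have := qs L'.
by move: hM'; rewrite -/(s L'); lra.
Qed.

End Scales.

(** * From cumulative bounds to upper density *)

Section Density.
Context {R : realType} {A : finType}.
Context (A0 : (0 < #|A|)%N).
Implicit Types (L M n N : nat).
Local Notation P := (@layer_measure R A).

Lemma cumulative_le_except (f : nat -> R) n0 c N :
  (forall n, f n <= 1) -> (forall n, (n0 <= n)%N -> f n <= c) -> 0 <= c ->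
  \sum_(n < N) f n <= n0%:R + c * N%:R.
Proof.
move=> f1 fc c0.
have const (a : R) q : \sum_(i < q) a = a * q%:R by rewrite sumr_const card_ord mulr_natr.
have [Nn|/ltnW nN] := leqP N n0.
  apply: (@le_trans _ _ (\sum_(n < N) 1)); first exact: ler_sum.
  rewrite const mul1r; apply: ler_wpDr; first by rewrite mulr_ge0 ?ler0n.
  by rewrite ler_nat.
rewrite -[in leLHS](subnKC nN) big_split_ord /= lerD //.
  apply: (@le_trans _ _ (\sum_(n < n0) 1)); first exact: ler_sum.
  by rewrite const mul1r.
apply: (@le_trans _ _ (\sum_(n < N - n0) c)).
  by apply: ler_sum => i _; rewrite fc ?leq_addr.
by rewrite const ler_wpM2l // ler_nat leq_subr.
Qed.

Lemma layer_measure_hits_ge (S : pred (seq A)) L n : (L <= n)%N ->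
  P S n <= P (hits S L n) n.
Proof.
move=> Ln; apply: layer_measureS => w sw Sw; apply/hitsP; exists w, [::].
by rewrite cats0 sw Ln leqnn.
Qed.

Lemma cumulative_strongly_product_free k (S : pred (seq A)) (e : R) :
  (2 <= k)%N -> strongly_product_free k S -> 0 < e ->
  exists C, forall N, k%:R * \sum_(n < N) P S n <= (1 + e) * N%:R + C.
Proof.
move=> k2 Sfree e0; have k0 : 0 < k%:R :> R by rewrite ltr0n; lia.
pose h L M := P (hits S L M) M.
have h01 L M : 0 <= h L M <= 1 by rewrite layer_measure_ge0 layer_measure_le1.
have hmono L M M' : (M <= M')%N -> h L M <= h L M'.
  move=> MM; rewrite /h -(layer_measure_hits A0 S L MM).
  by apply: layer_measureS => w _; apply: hits_widen.
have [small|[delta delta0 scale]] := scale_dichotomy h01 hmono.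
  have [L hL] := small (e / k%:R) (divr_gt0 e0 k0).
  exists (k%:R * L%:R) => N.
  have : \sum_(n < N) P S n <= L%:R + e / k%:R * N%:R.
    apply: cumulative_le_except => [n|n Ln|]; first exact: layer_measure_le1.
      by apply: le_trans (layer_measure_hits_ge S Ln) (hL n).
    by rewrite divr_ge0 ?ltW.
  rewrite -(ler_pM2l k0) mulrDr mulrA (mulrCA _ e) divff ?gt_eqF // mulr1.
  have := ler0n R N; lra.
(* With error [e / c], the first term pays for passing from [S] to [X], the second for the weight
   missing from [V]; together they cost exactly [e]. *)
pose c : R := k%:R + 2 * k%:R ^+ 2 / delta.
have c0 : 0 < c by rewrite addr_gt0 // divr_gt0 // mulr_gt0 // exprn_gt0.
have eps0 : 0 < e / c by rewrite divr_gt0.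
have [L [M [hd hM tail]]] := scale _ eps0.
have K0 : 0 < P (hits S L M) M by apply: lt_le_trans hd.
have [V [D [cV heavy]]] := exists_heavy_code A0 K0 eps0 tail.
have mu1 := code_weight_le1 A0 K0 cV.
have [VSK VD uV] := cV.
pose X : pred (seq A) := predI S (hits S L M).
exists (k%:R ^+ 2 * D%:R + k%:R * (maxn L M)%:R) => N.
have FX : k%:R * \sum_(n < N) P X n <=
    N%:R + k%:R ^+ 2 * (D%:R + (1 - \sum_(m < D) P V m) * N%:R).
  apply: (cumulative_product_free (K := hits S L M) A0 _ Sfree) => //.
  - by move=> u /VSK/andP[].
  - by move=> w /andP[].
  - by move=> w /andP[].
  - by move=> w; apply: concat_hits.
(* A word of [S] of length [n >= maxn L M] is its own prefix in [S]; if it is not in [K], it is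
   counted by [h L n - h L M]. *)
have FS : \sum_(n < N) (P S n - P X n) <= (maxn L M)%:R + e / c * N%:R.
  apply: (@cumulative_le_except (fun n => P S n - P X n)) => [n|n|]; last exact: ltW.
    by have := layer_measure_le1 (R := R) A0 S n; have := layer_measure_ge0 (R := R) X n; lra.
  rewrite geq_max => /andP[Ln Mn].
  have := @sum_layer_measure R A _ _ [:: S; hits S L M] [:: X; hits S L n] id id n.
  rewrite !big_cons !big_nil !addr0 (layer_measure_hits A0 S L Mn) => H.
  have := hM n; rewrite /h; suff : P S n + P (hits S L M) M <= P X n + P (hits S L n) n by lra.
  apply: H => w sw; rewrite !big_cons !big_nil !addn0 /X /=.
  case Sw: (S w) => /=; last first.
    by case Hw: (hits S L M w) => //; rewrite (hits_widen (leqnn L) Mn Hw).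
  suff -> : hits S L n w by rewrite addnC.
  by apply/hitsP; exists w, [::]; rewrite cats0 sw Ln leqnn.
rewrite sumrB in FS.
have eta : 1 - \sum_(m < D) P V m <= 2 * (e / c) / delta.
  rewrite ler_pdivlMr //; apply: le_trans heavy.
  by rewrite mulrC ler_wpM2r // subr_ge0.
have ec : k%:R * (e / c) + k%:R ^+ 2 * (2 * (e / c) / delta) = e.
  have -> : k%:R * (e / c) + k%:R ^+ 2 * (2 * (e / c) / delta) = c * (e / c) by rewrite /c; lra.
  by rewrite mulrC divfK ?gt_eqF.
move: FX FS eta ec; set F := \sum_(n < N) P S n; set G := \sum_(n < N) P X n.
set mu := 1 - _; set b := _ / delta; set a := e / c => FX FS eta ec.
have N0 := ler0n R N.
have FS' : k%:R * (F - G) <= k%:R * ((maxn L M)%:R + a * N%:R) by rewrite ler_pM2l.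
have muN : k%:R ^+ 2 * (mu * N%:R) <= k%:R ^+ 2 * (b * N%:R).
  by rewrite ler_wpM2l ?exprn_ge0 ?ler0n // ler_wpM2r.
have ecN : (k%:R * a + k%:R ^+ 2 * b) * N%:R = e * N%:R by rewrite ec.
move: FX FS' muN ecN; rewrite !(mulrDl, mulrDr, mulrBr, mulrA); lra.
Qed.

Lemma limn_esup_le (u : nat -> R) (c : R) :
  (forall e, 0 < e -> exists n0, forall n, (n0 <= n)%N -> u n <= c + e) ->
  (limn_esup (fun n => (u n)%:E) <= c%:E)%E.
Proof.
move=> uc; apply/lee_addgt0Pr => e e0; have [n0 un0] := uc e e0.
(* The upper limit is an infimum of suprema over eventual sets, one of which is the tail from
   [n0]. *)
apply: (@le_trans _ _ (ereal_sup [set (u n)%:E | n in [set n | (n0 <= n)%N]])%classic).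
  apply: ereal_inf_lbound; exists [set n | (n0 <= n)%N]%classic => //.
  exact: nbhs_infty_ge.
by apply: ge_ereal_sup => _ [n /= n0n <-]; rewrite -EFinD lee_fin un0.
Qed.

End Density.

Theorem theorem1p3 (R : realType) (A : finType) (k : nat) (S : pred (seq A)) :
  (0 < #|A|)%N -> (2 <= k)%N ->
  subset_free_semigroup S ->
  strongly_product_free k S ->
  (upper_density R S <= (k%:R^-1 : R)%:E)%E.
Proof.
move=> A0 k2 _ Sfree; apply: limn_esup_le => e e0.
have k0 : 0 < k%:R :> R by rewrite ltr0n; lia.
have ke0 : 0 < k%:R * e / 2 by rewrite !mulr_gt0 ?invr_gt0.
have [C HC] := cumulative_strongly_product_free (R := R) A0 k2 Sfree ke0.
(* Half of the allowance [k * e * n] covers the relative error, the other half must absorb [B]: the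
   constant [C] plus the cost of using [n.+1] layers, as the cumulative sums start at length 0. *)
pose B := C + 1 + k%:R * e / 2.
exists (Num.truncn (`|B| / (k%:R * e / 2))).+1 => n n0n.
have nB : B <= k%:R * e / 2 * n%:R.
  apply: le_trans (ler_norm B) _; rewrite mulrC -ler_pdivrMr //.
  apply: ltW; apply: lt_le_trans (truncnS_gt _) _.
  by rewrite ler_nat.
have n1 : 0 < n%:R :> R by rewrite ltr0n; apply: leq_trans n0n.
rewrite /density_ratio big_const_nat subSS subn0 iter_addr_0 ler_pdivrMr //.
rewrite -(ler_pM2l k0).
have := HC n.+1; rewrite big_ord_recl -(big_mkord xpredT (fun i => layer_measure R S i.+1)).
rewrite -(big_add1 _ _ 0 n.+1 xpredT) /= -[n.+1%:R]natr1 => Hn.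
have S0 := mulr_ge0 (ltW k0) (layer_measure_ge0 (R := R) S 0).
apply: (@le_trans _ _ ((1 + k%:R * e / 2) * (n%:R + 1) + C)).
  apply: le_trans Hn; rewrite mulrDr; lra.
rewrite [leRHS]mulrA [k%:R * (_ + e)]mulrDr divff ?gt_eqF //; move: nB; rewrite /B; lra.
Qed.
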